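(* Let $P_{Y|X}$ be a discrete memoryless channel with finite alphabets, capacity $C>0$ and $C_1<\infty$. Fix $\epsilon\in(0,1)$. Then, as $N\to\infty$, $$\log M^*(N,\epsilon)\ \ge\ \frac{NC}{1-\epsilon}-\frac{C}{C_1}\log N-\log\log N+O(1).$$
   Context: All logarithms are natural. $C=\max_{P_X}I(P_X,P_{Y|X})$ is the capacity and $C_1\triangleq\max_{(x,x')\in\mathcal{X}^2}D(P_{Y|X=x}\|P_{Y|X=x'})$, where $D$ is the Kullback–Leibler divergence. Noiseless feedback of past channel outputs is available to the encoder. An $(N,M,\epsilon)$-VLF code, for $N>0$, $M\in\mathbb{N}$, $\epsilon\in(0,1)$, consists of: (1) a common randomness random variable $U$ on a finite alphabet with distribution $P_U$, revealed to transmitter and receiver before transmission; (2) encoding functions $\mathsf{f}_t$ with $X_t=\mathsf{f}_t(U,W,Y^{t-1})\in\mathcal{X}$, $t\in\mathbb{N}$, where the message $W$ is uniform on $[M]$; (3) a stopping time $\tau\in\mathbb{N}$ of the filtration generated by $\{U,Y^t\}_{t\ge0}$ with $\mathbb{E}[\tau]\le N$; (4) a decoder $\hat W=\mathsf{g}_\tau(U,Y^\tau)\in[M]$ with $\Pr[\hat W\ne W]\le\epsilon$. The code may depend on $P_{Y|X}$. $M^*(N,\epsilon)$ is the largest $M$ for which an $(N,M,\epsilon)$-VLF code exists. *)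

(* Defs.v *)
From HB Require Import structures.
From mathcomp Require Import all_boot all_order all_algebra.
From mathcomp Require Import all_classical all_reals all_analysis.
Set Implicit Arguments. Unset Strict Implicit. Unset Printing Implicit Defensive.
Import Order.TTheory GRing.Theory Num.Theory.
Import numFieldNormedType.Exports.
Local Open Scope classical_set_scope.
Local Open Scope ring_scope.

Section DMC.
Variable R : realType.

Definition is_distr (T : finType) (P : T -> R) : Prop :=
  (forall t, 0 <= P t) /\ \sum_(t : T) P t = 1.

Variables X Y : finType.

Definition is_channel (W : X -> Y -> R) : Prop := forall x, is_distr (W x).

Definition out_dist (P : X -> R) (W : X -> Y -> R) (y : Y) : R :=
  \sum_(x : X) P x * W x y.

Definition mutual_info (P : X -> R) (W : X -> Y -> R) : R :=
  \sum_(x : X) \sum_(y : Y)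
     (if P x * W x y == 0 then 0
      else P x * W x y * ln (W x y / out_dist P W y)).

(* capacity C = max_{P_X} I(P_X, P_{Y|X}) (the sup is attained) *)
Definition capacity (W : X -> Y -> R) : R :=
  sup [set r | exists P : X -> R, is_distr P /\ r = mutual_info P W].

(* KL divergence D(p || q) in nats, for p << q (convention 0 log 0 = 0) *)
Definition KL (p q : Y -> R) : R :=
  \sum_(y : Y) (if p y == 0 then 0 else p y * ln (p y / q y)).

(* C_1 < oo  <=>  every pair of rows is mutually absolutely continuous *)
Definition C1_finite (W : X -> Y -> R) : Prop :=
  forall x x' y, W x' y = 0 -> W x y = 0.

(* C_1 = max_{(x,x')} D(P_{Y|X=x} || P_{Y|X=x'})  (meaningful when C1_finite) *)
Definition C1 (W : X -> Y -> R) : R :=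
  \big[Num.max/0]_(xx : X * X) KL (W xx.1) (W xx.2).

(* Time is implicit in the length of the past output sequence:
   X_t = f U W Y^{t-1} where Y^{t-1} is a sequence of length t-1. *)

Fixpoint path_prob (W : X -> Y -> R) (enc : seq Y -> X) (past ys : seq Y) : R :=
  if ys is y :: ys' then W (enc past) y * path_prob W enc (rcons past y) ys'
  else 1.

(* the stopping time (rule stop u y^t : "stop at time t") equals size ys *)
Definition stops_at (U : finType) (stop : U -> seq Y -> bool) (u : U) (ys : seq Y)
  : bool :=
  stop u ys && all (fun s => ~~ stop u (take s ys)) (iota 0 (size ys)).

Definition prob_tau (W : X -> Y -> R) (M : nat) (U : finType) (PU : U -> R)
  (f : U -> 'I_M -> seq Y -> X) (stop : U -> seq Y -> bool) (t : nat) : R :=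
  \sum_(u : U) \sum_(w : 'I_M) \sum_(ys : t.-tuple Y)
     PU u * M%:R^-1 * path_prob W (f u w) [::] ys * (stops_at stop u ys)%:R.

Definition prob_tau_correct (W : X -> Y -> R) (M : nat) (U : finType) (PU : U -> R)
  (f : U -> 'I_M -> seq Y -> X) (stop : U -> seq Y -> bool)
  (g : U -> seq Y -> 'I_M) (t : nat) : R :=
  \sum_(u : U) \sum_(w : 'I_M) \sum_(ys : t.-tuple Y)
     PU u * M%:R^-1 * path_prob W (f u w) [::] ys
       * (stops_at stop u ys && (g u ys == w))%:R.

Definition VLF_code_exists (W : X -> Y -> R) (N : R) (M : nat) (eps : R) : Prop :=
  exists (U : finType) (PU : U -> R) (f : U -> 'I_M -> seq Y -> X)
         (stop : U -> seq Y -> bool) (g : U -> seq Y -> 'I_M),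
    [/\ is_distr PU,
        series (prob_tau W PU f stop) @ \oo --> (1 : R),
        (exists Etau : R,
           series (fun t => t%:R * prob_tau W PU f stop t) @ \oo --> Etau
           /\ Etau <= N) &
        (exists Pc : R,
           series (prob_tau_correct W PU f stop g) @ \oo --> Pc
           /\ 1 - Pc <= eps)].

End DMC.

(* Main.v *)
Require Import Defs.
From HB Require Import structures.
From mathcomp Require Import all_boot all_order all_algebra.
From mathcomp Require Import all_classical all_reals all_analysis.
From mathcomp Require Import ring lra.
Set Implicit Arguments. Unset Strict Implicit. Unset Printing Implicit Defensive.
Import Order.TTheory GRing.Theory Num.Theory.
Import numFieldNormedType.Exports.
Local Open Scope ring_scope.

(** Let [l_i] be the posterior log-odds of message [i]. The encoder is chosen at
    each step as a function of the posterior. While no message has [l_i > 0],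
    a random i.i.d. encoder gives the log-odds of the true message a drift of at
    least [I(P, W)]. As soon as some [l_i > 0], the encoder sends [x0] for [i]
    and [x1] for all the others, where [(x0, x1)] attains [C1], and the log-odds
    of [i], if it is true, have drift exactly [C1]. Since [C1_finite] bounds the
    jumps of the log-odds, both regimes are controlled by a single function
    [pot], of slope [- 1 / I(P, W)] at minus infinity and [- 1 / C1] at plus
    infinity: the posterior mean of [pot l_i] decreases by at least 1 per step
    for a suitable deterministic encoder. Stopping when some message has odds
    at least [N] thus takes [ln M / I(P, W) + ln N / C1 + O(1)] steps on
    average, with error probability at most [1 / N]. Stopping at time 0 with
    probability [eps - 1 / N] divides the rate by [1 - eps] and brings the error
    probability up to [eps]. No [ln (ln N)] loss is incurred, because
    [pot] is averaged over the messages instead of being applied to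
    the average log-odds. *)

(** * Upper bounds for the exponential *)

Section ExpBounds.
Variable R : realType.
Implicit Types x s : R.

(** Multiply by [1 - x]: [expR x * (1 - x) <= 1], while [(1 + x + 2 x^2) (1 - x) = 1 + x^2 (1 - 2 x)
    >= 1]. *)
Lemma expR_le_quadratic x : x <= 2^-1 -> expR x <= 1 + x + 2 * x ^+ 2.
Proof.
move=> hx; have x1 : 0 < 1 - x by lra.
have h : expR x * (1 - x) <= 1.
  by rewrite -[leRHS](expRxMexpNx_1 x) ler_pM2l ?expR_gt0//; apply: expR_ge1Dx.
rewrite -(ler_pM2r x1); apply: le_trans h _; nra.
Qed.

(** Convexity: the tangent at [s * x] is evaluated at [x] and at 0, and the weights [s] and [1 - s]
    cancel the linear terms. *)
Lemma expR_scale_le s x : 0 <= s <= 1 -> expR (s * x) <= 1 - s + s * expR x.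
Proof.
move=> /andP[s0 s1].
have h1 : expR (s * x) * (1 + (1 - s) * x) <= expR x.
  have -> : expR x = expR (s * x) * expR ((1 - s) * x).
    by rewrite -expRD; congr expR; ring.
  by rewrite ler_pM2l ?expR_gt0//; apply: expR_ge1Dx.
have h2 : expR (s * x) * (1 - s * x) <= 1.
  by rewrite -[leRHS](expRxMexpNx_1 (s * x)) ler_pM2l ?expR_gt0//; apply: expR_ge1Dx.
have s1' : 0 <= 1 - s by rewrite subr_ge0.
have := ler_wpM2l s0 h1; have := ler_wpM2l s1' h2; lra.
Qed.

End ExpBounds.

(** * Log-likelihood ratios and divergence *)

Section LogRatio.
Variables (R : realType) (Y : finType).
Implicit Types (p q : Y -> R) (c s l : R).

(** Without division, the bound covers zeros (distributions so related vanish together) and passes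
    to mixtures. *)
Definition ratio_bounded c p q := forall y, p y <= expR c * q y /\ q y <= expR c * p y.

Lemma KLE p q : KL p q = \sum_y p y * ln (p y / q y).
Proof. by apply: eq_bigr => y _; case: eqP => // ->; rewrite mul0r. Qed.

Lemma log_ratio_le c p q y : ratio_bounded c p q -> 0 < p y ->
  0 < q y /\ `|ln (p y / q y)| <= c.
Proof.
move=> /(_ y)[h1 h2] py.
have qy : 0 < q y by have := lt_le_trans py h1; rewrite pmulr_rgt0 ?expR_gt0.
split=> //; rewrite ler_norml; apply/andP; split.
  rewrite -ler_expR lnK ?posrE ?divr_gt0// expRN.
  by rewrite ler_pdivlMr// ler_pdivrMl ?expR_gt0.
by rewrite -ler_expR lnK ?posrE ?divr_gt0// ler_pdivrMr.
Qed.

Lemma KL_ge0 c p q : is_distr p -> is_distr q -> ratio_bounded c p q -> 0 <= KL p q.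
Proof.
move=> [p0 p1] [q0 q1] hc; rewrite KLE -[leLHS](_ : \sum_y (p y - q y) = 0).
  apply: ler_sum => y _; have := p0 y; rewrite le_eqVlt => /orP[/eqP py|py].
    have := (hc y).2; rewrite -py mulr0 mul0r => qy.
    have -> : q y = 0 by apply/eqP; rewrite eq_le qy q0.
    by rewrite subrr.
  have [qy _] := log_ratio_le hc py.
  rewrite -[ln _]opprK -lnV ?posrE ?divr_gt0// invf_div.
  have h : ln (q y / p y) <= q y / p y - 1.
    rewrite -[X in ln X](subrK 1) addrC; apply: le_ln1Dx.
    by rewrite -subr_gt0 opprK subrK divr_gt0.
  have -> : p y - q y = p y * - (q y / p y - 1).
    by rewrite mulrN mulrBr mulr1 mulrCA divff ?gt_eqF// mulr1 opprB.
  by rewrite ler_pM2l// lerN2.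
by rewrite sumrB p1 q1 subrr.
Qed.

(** Weighted AM-GM, [p^(1-s) q^s <= (1 - s) p + s q]. Thus the exponential in [late] never grows on
    average, however small the divergence. *)
Lemma mean_exp_le c s p q : is_distr p -> is_distr q -> ratio_bounded c p q ->
  0 <= s <= 1 -> \sum_y p y * expR (- (s * ln (p y / q y))) <= 1.
Proof.
move=> [p0 p1] [q0 q1] hc hs.
rewrite -[leRHS](_ : \sum_y ((1 - s) * p y + s * q y) = 1); last first.
  by rewrite big_split/= -!mulr_sumr p1 q1; ring.
apply: ler_sum => y _; have := p0 y; rewrite le_eqVlt => /orP[/eqP <-|py].
  rewrite mul0r mulr0 add0r mulr_ge0//; by case/andP: hs.
have [qy _] := log_ratio_le hc py.
rewrite -mulrN; apply: le_trans (ler_wpM2l (ltW py) (expR_scale_le _ hs)) _.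
rewrite expRN lnK ?posrE ?divr_gt0// invf_div le_eqVlt; apply/orP; left.
by apply/eqP; field; rewrite gt_eqF.
Qed.

Lemma mean_exp_quadratic c s p q : is_distr p -> ratio_bounded c p q ->
  0 <= s -> s * c <= 2^-1 ->
  \sum_y p y * expR (- (s * ln (p y / q y))) <= 1 - s * KL p q + 2 * (s * c) ^+ 2.
Proof.
move=> [p0 p1] hc s0 sc.
rewrite KLE -[leRHS](_ : \sum_y (p y - s * (p y * ln (p y / q y)) + 2 * (s * c) ^+ 2 * p y) = _).
  apply: ler_sum => y _; have := p0 y; rewrite le_eqVlt => /orP[/eqP <-|py].
    by rewrite !(mul0r, mulr0, subr0, addr0).
  have [qy] := log_ratio_le hc py.
  move: (ln _) => z hz.
  have hsz : `|s * z| <= s * c by rewrite normrM ger0_norm// ler_wpM2l.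
  have h : - (s * z) <= 2^-1.
    by apply: le_trans sc; apply: le_trans hsz; rewrite -normrN ler_norm.
  apply: le_trans (ler_wpM2l (ltW py) (expR_le_quadratic h)) _.
  have : (s * z) ^+ 2 <= (s * c) ^+ 2.
    by rewrite -[(s * z) ^+ 2]real_normK ?num_real// lerXn2r// nnegrE (le_trans _ hsz).
  move=> h2; have := ler_wpM2l (ltW py) h2; nra.
by rewrite big_split/= sumrB -!mulr_sumr p1; ring.
Qed.

End LogRatio.

(** * Independent random inputs, one per message *)

Section ProductWeight.
Variables (R : realType) (X I : finType) (P : X -> R).
Hypothesis dP : is_distr P.

Definition prod_weight (g : {ffun I -> X}) := \prod_i P (g i).

(** Distributivity gives a product of sums in which every coordinate other than [i] and [j]
    contributes 1. *)
Lemma prod_weight_marginals (i j : I) (h k : X -> R) : i != j ->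
  \sum_g prod_weight g * (h (g i) * k (g j)) =
  (\sum_x P x * h x) * (\sum_x P x * k x).
Proof.
move=> ij.
pose F l x := P x * ((if l == i then h x else 1) * (if l == j then k x else 1)).
rewrite (eq_bigr (fun g : {ffun I -> X} => \prod_l F l (g l))); last first.
  move=> g _; rewrite !big_split /=; congr (_ * (_ * _)).
    by rewrite -big_mkcond big_pred1_eq.
  by rewrite -big_mkcond big_pred1_eq.
rewrite -bigA_distr_bigA (bigD1 i) //= (bigD1 j) 1?eq_sym //=.
rewrite [X in _ * (_ * X)]big1 ?mulr1.
  congr (_ * _); apply: eq_bigr => x _; rewrite /F eqxx.
    by rewrite (negbTE ij) mulr1.
  by rewrite eq_sym (negbTE ij) mul1r.
move=> l /andP[/negbTE li /negbTE lj]; rewrite -[RHS]dP.2.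
by apply: eq_bigr => x _; rewrite /F li lj !mulr1.
Qed.

Lemma prod_weight_marginal (i : I) (h : X -> R) :
  \sum_g prod_weight g * h (g i) = \sum_x P x * h x.
Proof.
pose F l x := P x * (if l == i then h x else 1).
rewrite (eq_bigr (fun g : {ffun I -> X} => \prod_l F l (g l))); last first.
  by move=> g _; rewrite big_split /= -big_mkcond big_pred1_eq.
rewrite -bigA_distr_bigA (bigD1 i) //= [X in _ * X]big1 ?mulr1.
  by apply: eq_bigr => x _; rewrite /F eqxx.
move=> l /negbTE li; rewrite -[RHS]dP.2.
by apply: eq_bigr => x _; rewrite /F li !mulr1.
Qed.

Lemma prod_weight_distr : is_distr prod_weight.
Proof.
split=> [g|]; first by apply: prodr_ge0 => i _; apply: dP.1.
rewrite -(bigA_distr_bigA (fun (_ : I) x => P x)) big1 // => i _; exact: dP.2.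
Qed.

End ProductWeight.

(** * Mutual information and random encoders *)

Section Information.
Variables (R : realType) (X Y : finType) (W : X -> Y -> R) (c : R) (P : X -> R).
Hypotheses (hW : is_channel W) (hc : forall x x', ratio_bounded c (W x) (W x')).
Hypothesis dP : is_distr P.

Lemma mix_distr (T : finType) (v : T -> R) (q : T -> Y -> R) :
  is_distr v -> (forall t, is_distr (q t)) ->
  is_distr (fun y => \sum_t v t * q t y).
Proof.
move=> [v0 v1] dq; split=> [y|].
  by apply: sumr_ge0 => t _; rewrite mulr_ge0 // (dq t).1.
rewrite exchange_big /= -[RHS]v1; apply: eq_bigr => t _.
by rewrite -mulr_sumr (dq t).2 mulr1.
Qed.

Lemma mix_ratio_bounded (T : finType) (v : T -> R) (p : Y -> R) (q : T -> Y -> R) :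
  is_distr v -> (forall t, ratio_bounded c p (q t)) ->
  ratio_bounded c p (fun y => \sum_t v t * q t y).
Proof.
move=> [v0 v1] h y; split.
  rewrite -[p y]mul1r -v1 mulr_suml mulr_sumr; apply: ler_sum => t _.
  by rewrite mulrCA ler_wpM2l // (h t y).1.
rewrite -[p y]mul1r -v1 mulr_suml mulr_sumr; apply: ler_sum => t _.
by rewrite mulrCA ler_wpM2l // (h t y).2.
Qed.

Lemma out_dist_ratio x : ratio_bounded c (W x) (out_dist P W).
Proof. exact: mix_ratio_bounded. Qed.

Lemma mutual_infoE : mutual_info P W = \sum_x P x * KL (W x) (out_dist P W).
Proof.
apply: eq_bigr => x _; rewrite KLE mulr_sumr; apply: eq_bigr => y _.
by rewrite mulrA; case: eqP => // ->; rewrite mul0r.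
Qed.

(* ln (q / r) <= q / r - 1 averaged over p: the bound is linear in q, so that
   averages over random mixtures q only involve pairwise marginals. *)
Lemma KL_tangent (p q r : Y -> R) : is_distr p ->
  ratio_bounded c p q -> ratio_bounded c p r ->
  KL p r + \sum_y p y * (1 - q y / r y) <= KL p q.
Proof.
move=> dp hq hr; rewrite !KLE -big_split /=; apply: ler_sum => y _.
have := dp.1 y; rewrite le_eqVlt => /orP[/eqP <-|py]; first by rewrite !mul0r addr0.
have [qy _] := log_ratio_le hq py; have [ry _] := log_ratio_le hr py.
rewrite -mulrDr ler_pM2l //.
have h : ln (q y / r y) <= q y / r y - 1.
  rewrite -[X in ln X](subrK 1) addrC; apply: le_ln1Dx.
  by rewrite -subr_gt0 opprK subrK divr_gt0.
rewrite !ln_div ?posrE // in h *; lra.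
Qed.

(** Convexity of divergence in its second argument: [KL_tangent] at [out_dist P W] is averaged over
    [x'], and the linear terms cancel. *)
Lemma mutual_info_le_C1 : mutual_info P W <= C1 W.
Proof.
rewrite mutual_infoE -[leRHS]mul1r -dP.2 mulr_suml; apply: ler_sum => x _.
rewrite ler_wpM2l ?dP.1 //.
rewrite -[leRHS]mul1r -dP.2 mulr_suml.
apply: (@le_trans _ _ (\sum_x' P x' * (KL (W x) (out_dist P W) +
    \sum_y W x y * (1 - W x' y / out_dist P W y)))); last first.
  apply: ler_sum => x' _; rewrite ler_wpM2l ?dP.1 //.
  apply: le_trans (KL_tangent (hW x) (hc x x') (out_dist_ratio x)) _.
  exact: (@le_bigmax _ _ _ 0 (fun xx : X * X => KL (W xx.1) (W xx.2)) (x, x')).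
rewrite le_eqVlt; apply/orP; left; apply/eqP.
under [RHS]eq_bigr do rewrite mulrDr.
rewrite big_split /= -mulr_suml dP.2 mul1r.
under [X in _ = _ + X]eq_bigr do rewrite mulr_sumr.
rewrite exchange_big big1 ?addr0 //= => y _.
have := (hW x).1 y; rewrite le_eqVlt => /orP[/eqP <-|Wy].
  by rewrite big1 // => i _; rewrite mul0r mulr0.
have [oy _] := log_ratio_le (out_dist_ratio x) Wy.
transitivity (W x y * (\sum_i P i - out_dist P W y / out_dist P W y)).
  rewrite mulrBr mulr_sumr /out_dist mulr_suml mulr_sumr -sumrB.
  by apply: eq_bigr => i _; ring.
by rewrite dP.2 divff ?gt_eqF // subrr mulr0.
Qed.

(** Here [v] is the law of the competing messages. The tangent correction has mean zero: [v i = 0]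
    leaves only [j != i], for which [g i] and [g j] are independent. *)
Lemma mean_KL_random_encoder (I : finType) (v : I -> R) (i : I) :
  is_distr v -> v i = 0 ->
  mutual_info P W <= \sum_(g : {ffun I -> X}) prod_weight P g *
    KL (W (g i)) (fun y => \sum_j v j * W (g j) y).
Proof.
move=> dv vi; have [w0 w1] := prod_weight_distr I dP.
apply: (@le_trans _ _ (\sum_(g : {ffun I -> X}) prod_weight P g *
  (KL (W (g i)) (out_dist P W) +
   \sum_y W (g i) y * (1 - (\sum_j v j * W (g j) y) / out_dist P W y)))); last first.
  apply: ler_sum => g _; rewrite ler_wpM2l //.
  apply: KL_tangent => //; last exact: out_dist_ratio.
  exact: mix_ratio_bounded.
under [leRHS]eq_bigr do rewrite mulrDr.
rewrite big_split /= (prod_weight_marginal dP i (fun x => KL (W x) (out_dist P W))).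
rewrite mutual_infoE le_eqVlt; apply/orP; left; apply/eqP.
under [X in _ = _ + X]eq_bigr do rewrite mulr_sumr.
rewrite exchange_big [X in _ = _ + X]big1 ?addr0 //= => y _.
set r := out_dist P W y.
transitivity (\sum_g prod_weight P g * W (g i) y - \sum_j v j / r *
   \sum_g prod_weight P g * (W (g i) y * W (g j) y)).
  under [X in _ = _ - X]eq_bigr do rewrite mulr_sumr.
  rewrite exchange_big -sumrB /=; apply: eq_bigr => g _.
  rewrite mulrBr mulr1 mulrBr mulr_suml !mulr_sumr; congr (_ - _).
  by apply: eq_bigr => j _; ring.
rewrite (prod_weight_marginal dP i (W^~ y)) -[X in X - _]/r.
rewrite (eq_bigr (fun j => v j * (r * r / r))); last first.
  move=> j _; have [->|ij] := eqVneq j i; first by rewrite vi !mul0r.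
  have -> : \sum_g prod_weight P g * (W (g i) y * W (g j) y) = r * r.
    by apply: (prod_weight_marginals dP (W^~ y) (W^~ y)); rewrite eq_sym.
  by ring.
rewrite -mulr_suml dv.2 mul1r.
by have [->|r0] := eqVneq r 0; rewrite ?mul0r ?subrr // mulfK // subrr.
Qed.

End Information.

(** Derandomization: a good average drift yields one good deterministic encoder. *)
Lemma exists_le_mean (R : realType) (T : finType) (w F : T -> R) (B : R) :
  is_distr w -> \sum_t w t * F t <= B -> exists t, F t <= B.
Proof.
move=> [w0 w1] hB; apply: contrapT => /forallNP h.
have hF t : B < F t by rewrite ltNge; apply/negP; exact: h.
have : \sum_t w t * (F t - B) = 0.
  apply: le_anti; rewrite [X in _ && X]sumr_ge0 ?andbT; last first.
    by move=> t _; rewrite mulr_ge0 // subr_ge0 ltW.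
  under eq_bigr do rewrite mulrBr.
  by rewrite sumrB -mulr_suml w1 mul1r subr_le0.
move/psumr_eq0P => hz; move: w1; rewrite big1 => [/esym/eqP|t _].
  by rewrite oner_eq0.
have /eqP := hz (fun t _ => mulr_ge0 (w0 t) (ltW (etrans (subr_gt0 _ _) (hF t)))) t isT.
by rewrite mulf_eq0 subr_eq0 [F t == B]gt_eqF // orbF => /eqP.
Qed.

(** * The potential of a single log-odds *)

Section Potential.
Variables (R : realType) (Cp D1 s a b c : R).

Definition early l := - l / Cp + b.
Definition late l := - l / D1 + a * expR (- (s * l)).
(* Below 0, the random encoder gives each branch of the minimum a drift of at
   most -1; for [late] this is due to the exponential. Above 0 the minimum cannot
   be kept, because [early] eventually falls below [late]; as [late <= early] on
   [0, c], a jump of size at most c from below 0 does not see the difference. *)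
Definition pot l := if l <= 0 then Num.min (early l) (late l) else late l.

(** [sc] allows the quadratic expansion, [sc2] keeps its error below half of the first-order gain at
    divergence [Cp], [asC] makes the other half worth a full step, and [bac] puts [late] below
    [early] on [[0, c]]. *)
Hypotheses (Cp0 : 0 < Cp) (CpD1 : Cp <= D1) (s0 : 0 <= s) (s1 : s <= 1) (c0 : 0 <= c).
Hypotheses (sc : s * c <= 2^-1) (sc2 : 2 * (s * c) ^+ 2 <= s * Cp / 2).
Hypotheses (a0 : 0 <= a) (asC : 1 <= a * (s * Cp / 2)) (bac : a + c / Cp <= b).

Let D1_gt0 : 0 < D1. Proof. exact: lt_le_trans CpD1. Qed.

Lemma pot_le_late l : pot l <= late l.
Proof. by rewrite /pot; case: ifP => // _; rewrite ge_min lexx orbT. Qed.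

Lemma late_le_early l : 0 <= l -> l <= c -> late l <= early l.
Proof.
move=> l0 lc; rewrite /late /early.
have h1 : - l / D1 <= 0 by rewrite mulNr oppr_le0 divr_ge0 // ltW.
have h2 : a * expR (- (s * l)) <= a.
  by rewrite ler_piMr // -expR0 ler_expR oppr_le0 mulr_ge0.
have h3 : l / Cp <= c / Cp by rewrite ler_pM2r ?invr_gt0.
apply: le_trans (lerD h1 h2) _; rewrite add0r mulNr.
by move: bac h3; move: (c / Cp) (l / Cp) => u v; lra.
Qed.

Lemma pot_le_early l : l <= c -> pot l <= early l.
Proof.
move=> lc; rewrite /pot; case: (lerP l 0) => l0; first by rewrite ge_min lexx.
by apply: late_le_early => //; apply: ltW.
Qed.

Lemma pot_eq_late l : 0 <= l -> pot l = late l.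
Proof.
rewrite /pot le_eqVlt => /orP[/eqP <-|l0]; last by rewrite leNgt l0.
by rewrite lexx min_r // late_le_early.
Qed.

Lemma pot_ge l B : 0 <= B -> l <= B -> - (B / D1) <= pot l.
Proof.
move=> B0 lB.
have b0 : 0 <= b by apply: le_trans bac; rewrite addr_ge0 // divr_ge0 // ltW.
have hl : - (B / D1) <= late l.
  rewrite -[leLHS]addr0 /late lerD//; last by rewrite mulr_ge0 // expR_ge0.
  by rewrite -mulNr ler_pM2r ?invr_gt0 // lerN2.
rewrite /pot; case: (lerP l 0) => l0 //; rewrite le_min hl andbT.
apply: (@le_trans _ _ 0); first by rewrite oppr_le0 divr_ge0 // ltW.
by rewrite /early addr_ge0 // mulNr oppr_ge0 pmulr_lle0 // invr_gt0.
Qed.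

(** * Mean change of the potential over one output *)

Variable Y : finType.
Implicit Types p q : Y -> R.

Definition mean_pot p q l := \sum_y p y * pot (l + ln (p y / q y)).

Lemma mean_early p q l : is_distr p ->
  \sum_y p y * early (l + ln (p y / q y)) = early l - KL p q / Cp.
Proof.
move=> [p0 p1]; rewrite KLE /early mulr_suml -sumrN.
rewrite -[_ + b]mulr1 -p1 mulr_sumr -big_split /=.
by apply: eq_bigr => y _; ring.
Qed.

Lemma mean_lateE p q l : is_distr p ->
  \sum_y p y * late (l + ln (p y / q y)) =
  - l / D1 - KL p q / D1 +
  a * expR (- (s * l)) * \sum_y p y * expR (- (s * ln (p y / q y))).
Proof.
move=> [p0 p1]; rewrite KLE mulr_suml mulr_sumr.
rewrite -sumrN -[- l / D1]mulr1 -p1 mulr_sumr -!big_split /=.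
apply: eq_bigr => y _; rewrite /late.
have -> : - (s * (l + ln (p y / q y))) = - (s * l) + - (s * ln (p y / q y)) by ring.
by rewrite expRD; ring.
Qed.

Lemma mean_late p q l : is_distr p -> ratio_bounded c p q ->
  \sum_y p y * late (l + ln (p y / q y)) <=
  late l - KL p q / D1 - a * expR (- (s * l)) * (s * KL p q - s * Cp / 2).
Proof.
move=> dp hc; rewrite mean_lateE // /late.
have e0 : 0 <= a * expR (- (s * l)) by rewrite mulr_ge0 // expR_ge0.
have := ler_wpM2l e0 (mean_exp_quadratic dp hc s0 sc).
have := ler_wpM2l e0 sc2.
lra.
Qed.

(** For the unlikely messages during confirmation, whose increments may carry no useful
    divergence. *)
Lemma mean_pot_le_pot p q l : is_distr p -> is_distr q -> ratio_bounded c p q ->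
  l <= 0 -> mean_pot p q l <= pot l.
Proof.
move=> dp dq hc l0; have KL0 := KL_ge0 dp dq hc.
rewrite [leRHS]/pot l0 le_min; apply/andP; split.
  apply: (@le_trans _ _ (\sum_y p y * early (l + ln (p y / q y)))).
    apply: ler_sum => y _; have := dp.1 y; rewrite le_eqVlt => /orP[/eqP <-|py].
      by rewrite !mul0r.
    rewrite ler_pM2l // pot_le_early //.
    have [_] := log_ratio_le hc py; rewrite ler_norml => /andP[_]; lra.
  by rewrite mean_early // gerBl divr_ge0 // ltW.
apply: (@le_trans _ _ (\sum_y p y * late (l + ln (p y / q y)))).
  by apply: ler_sum => y _; rewrite ler_wpM2l ?dp.1 // pot_le_late.
rewrite mean_lateE // /late lerD //; first by rewrite gerBl divr_ge0 // ltW.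
rewrite ler_piMr ?mulr_ge0 ?expR_ge0 //.
by apply: mean_exp_le dp dq hc _; rewrite s0.
Qed.

(** The linear part of [late] gives the drift -1 and its exponential the surplus [expR (- l)], the
    inverse odds, which will pay for all the other messages. *)
Lemma mean_pot_confirm p q l : is_distr p -> ratio_bounded c p q ->
  KL p q = D1 -> 0 <= l -> mean_pot p q l <= pot l - 1 - expR (- l).
Proof.
move=> dp hc hKL l0.
apply: (@le_trans _ _ (\sum_y p y * late (l + ln (p y / q y)))).
  by apply: ler_sum => y _; rewrite ler_wpM2l ?dp.1 // pot_le_late.
apply: le_trans (mean_late _ dp hc) _.
rewrite pot_eq_late // hKL divff ?gt_eqF // lerD2l lerN2.
apply: (@le_trans _ _ (expR (- (s * l)))).
  by rewrite ler_expR lerN2 ler_piMl.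
have h : 1 <= a * (s * D1 - s * Cp / 2).
  apply: le_trans asC _; rewrite ler_wpM2l //.
  by have := ler_wpM2l s0 CpD1; lra.
by rewrite mulrAC ler_peMl ?expR_ge0.
Qed.

Lemma mean_pot_random (T : finType) (w : T -> R) (p q : T -> Y -> R) l :
  is_distr w -> (forall t, is_distr (p t)) ->
  (forall t, ratio_bounded c (p t) (q t)) ->
  Cp <= \sum_t w t * KL (p t) (q t) -> l <= 0 ->
  \sum_t w t * mean_pot (p t) (q t) l <= pot l - 1.
Proof.
move=> [w0 w1] dp hc hKL l0.
rewrite [in leRHS]/pot l0 lerBrDr le_min -!lerBrDr; apply/andP; split.
  apply: (@le_trans _ _ (\sum_t w t * (early l - KL (p t) (q t) / Cp))).
    apply: ler_sum => t _; rewrite ler_wpM2l // -mean_early //.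
    apply: ler_sum => y _; have := (dp t).1 y; rewrite le_eqVlt => /orP[/eqP <-|py].
      by rewrite !mul0r.
    rewrite ler_pM2l // pot_le_early //.
    have [_] := log_ratio_le (hc t) py; rewrite ler_norml => /andP[_]; lra.
  rewrite (eq_bigr (fun t => early l * w t - Cp^-1 * (w t * KL (p t) (q t)))); last first.
    by move=> t _; ring.
  rewrite sumrB -!mulr_sumr w1 mulr1 lerD2l lerN2.
  by rewrite mulrC ler_pdivlMr // mul1r.
have D1V : 0 <= D1^-1 by rewrite invr_ge0 ltW.
apply: (@le_trans _ _ (\sum_t w t * (late l - KL (p t) (q t) / D1 -
    a * expR (- (s * l)) * (s * KL (p t) (q t) - s * Cp / 2)))).
  apply: ler_sum => t _; rewrite ler_wpM2l //.
  apply: le_trans (mean_late _ (dp t) (hc t)).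
  by apply: ler_sum => y _; rewrite ler_wpM2l ?(dp t).1 // pot_le_late.
set e := a * expR _; set K := \sum_t _ in hKL.
have e0 : 0 <= e by rewrite mulr_ge0 // expR_ge0.
rewrite (eq_bigr (fun t => (late l + e * (s * Cp / 2)) * w t -
    (D1^-1 + e * s) * (w t * KL (p t) (q t)))); last by move=> t _; ring.
rewrite sumrB -!mulr_sumr w1 mulr1 -/K.
(* Since [l <= 0], the exponential is at least 1 and alone provides the unit drift. *)
have h1 : 1 <= e * (s * Cp / 2).
  apply: le_trans asC _; rewrite ler_wpM2r //.
    by rewrite divr_ge0 // mulr_ge0 // ltW.
  rewrite ler_peMr // -[leLHS]expR0 ler_expR oppr_ge0.
  exact: mulr_ge0_le0.
have h2 : (D1^-1 + e * s) * Cp <= (D1^-1 + e * s) * K.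
  by rewrite ler_wpM2l // addr_ge0 // mulr_ge0.
have h3 : 0 <= D1^-1 * Cp by rewrite mulr_ge0 // ltW.
nra.
Qed.

(** * Posterior weights and the Lyapunov function *)

Variables (X : finType) (W : X -> Y -> R) (P : X -> R) (x0 x1 : X).
Hypotheses (hW : is_channel W) (hc : forall x x', ratio_bounded c (W x) (W x')).
Hypotheses (dP : is_distr P) (hI : Cp <= mutual_info P W).
Hypothesis hx : KL (W x0) (W x1) = D1.

Variable M : nat.
Implicit Types (L : 'I_M -> R) (g : 'I_M -> X).

Definition rest L i := \sum_(j | j != i) L j.
Definition log_odds L i := ln (L i / rest L i).
(* [L] is unnormalized: L i is the joint probability of message i and the past outputs. *)
Definition lyapunov L := \sum_i L i * pot (log_odds L i).
Definition update L g y : 'I_M -> R := fun i => L i * W (g i) y.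

(** Posterior law of the message given that it is not [i]; [other_output] is the induced output law,
    against which the log-odds of [i] move. *)
Definition other_weight L (i j : 'I_M) := if j == i then 0 else L j / rest L i.
Definition other_output L g i y := \sum_j other_weight L i j * W (g j) y.

Lemma sum_rest L i : \sum_j L j = L i + rest L i.
Proof. by rewrite (bigD1 i). Qed.

Hypothesis M1 : (1 < M)%N.

Lemma rest_gt0 L i : (forall j, 0 < L j) -> 0 < rest L i.
Proof.
move=> L0; have [j ji] : exists j : 'I_M, j != i.
  have [i0|i0] := eqVneq (i : nat) 0%N.
    by exists (Ordinal M1); rewrite -val_eqE /= i0.
  by exists (Ordinal (ltnW M1)); rewrite -val_eqE /= eq_sym.
rewrite /rest (bigD1 j) //= ltr_pwDl //.
by apply: sumr_ge0 => k _; exact: ltW.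
Qed.

Lemma log_odds_uniform i : - ln M%:R <= log_odds (fun=> M%:R^-1) i <= 0.
Proof.
have M0 : 0 < M%:R :> R by rewrite ltr0n ltnW.
have L0 : 0 < M%:R^-1 :> R by rewrite invr_gt0.
have r0 := rest_gt0 i (fun _ : 'I_M => L0).
have : M%:R^-1 + rest (fun=> M%:R^-1) i = 1.
  rewrite -(sum_rest (fun=> M%:R^-1)) sumr_const card_ord -[_ *+ M]mulr_natr.
  by rewrite mulVf // gt_eqF.
move=> /(canRL (addKr _)) hr; apply/andP; split.
  rewrite -lnV ?posrE // ler_ln ?posrE ?divr_gt0 // ler_pdivlMr //.
  by apply: ler_piMr; rewrite ?hr; lra.
apply: ln_le0; rewrite ler_pdivrMr // mul1r hr addrC lerBrDr -mulr2n -[leLHS]mulr_natl.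
by rewrite ler_pdivrMr // mul1r ler_nat.
Qed.

Lemma other_weight_distr L i : (forall j, 0 < L j) -> is_distr (other_weight L i).
Proof.
move=> L0; have r0 := rest_gt0 i L0; split=> [j|].
  by rewrite /other_weight; case: ifP => // _; rewrite divr_ge0 // ltW.
rewrite (bigD1 i) //= /other_weight eqxx add0r.
rewrite (eq_bigr (fun j => L j / rest L i)) => [|j /negbTE -> //].
by rewrite -mulr_suml divff // gt_eqF.
Qed.

Lemma rest_update L g i y : 0 < rest L i ->
  rest (update L g y) i = rest L i * other_output L g i y.
Proof.
move=> r0; rewrite /other_output (bigD1 i) //= /other_weight eqxx mul0r add0r mulr_sumr.
by apply: eq_bigr => j /negbTE ->; rewrite /update; field; rewrite gt_eqF.
Qed.

Lemma other_output_distr L g i : (forall j, 0 < L j) -> is_distr (other_output L g i).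
Proof. by move=> L0; apply: mix_distr => //; exact: other_weight_distr. Qed.

Lemma other_output_ratio L g i : (forall j, 0 < L j) ->
  ratio_bounded c (W (g i)) (other_output L g i).
Proof. by move=> L0; apply: mix_ratio_bounded => //; exact: other_weight_distr. Qed.

Lemma log_odds_update L g y i : (forall j, 0 < L j) -> 0 < W (g i) y ->
  log_odds (update L g y) i = log_odds L i + ln (W (g i) y / other_output L g i y).
Proof.
move=> L0 Wy; have r0 := rest_gt0 i L0.
have [q0 _] := log_ratio_le (other_output_ratio g i L0) Wy.
rewrite /log_odds -lnM ?posrE ?divr_gt0 //; congr ln.
by rewrite rest_update // /update; field; rewrite !gt_eqF.
Qed.

(** Log-odds are scale invariant, so with unnormalized weights a plain sum over outputs acts as the
    expectation. *)
Lemma mean_lyapunov_update L g : (forall j, 0 < L j) ->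
  \sum_y lyapunov (update L g y) =
  \sum_i L i * mean_pot (W (g i)) (other_output L g i) (log_odds L i).
Proof.
move=> L0; rewrite exchange_big /=; apply: eq_bigr => i _.
rewrite mulr_sumr; apply: eq_bigr => y _.
have := (hW (g i)).1 y; rewrite le_eqVlt => /orP[/eqP Wy|Wy].
  by rewrite /update -Wy !(mulr0, mul0r).
by rewrite log_odds_update // -mulrA.
Qed.

Lemma lyapunov_ge L B : 0 <= B -> (forall j, 0 < L j) -> (forall i, log_odds L i <= B) ->
  - (B / D1 * \sum_i L i) <= lyapunov L.
Proof.
move=> B0 L0 hB; rewrite mulr_sumr -sumrN; apply: ler_sum => i _.
by rewrite -mulNr mulrC ler_pM2l // pot_ge.
Qed.

Lemma lyapunov_uniform : lyapunov (fun=> M%:R^-1) <= ln M%:R / Cp + b.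
Proof.
have M0 : 0 < M%:R :> R by rewrite ltr0n ltnW.
have -> : ln M%:R / Cp + b = \sum_(i < M) M%:R^-1 * (ln M%:R / Cp + b).
  rewrite -mulr_suml sumr_const card_ord -[M%:R^-1 *+ M]mulr_natr.
  by rewrite mulVf ?gt_eqF // mul1r.
apply: ler_sum => i _; rewrite ler_pM2l ?invr_gt0 //.
have /andP[h1 h2] := log_odds_uniform i.
apply: le_trans (pot_le_early (le_trans h2 c0)) _.
by rewrite /early lerD2r // ler_pM2r ?invr_gt0 // lerNl.
Qed.

Lemma drift_random L : (forall j, 0 < L j) -> (forall j, log_odds L j <= 0) ->
  exists g : {ffun 'I_M -> X},
    \sum_y lyapunov (update L g y) <= lyapunov L - \sum_i L i.
Proof.
move=> L0 hL; apply: (exists_le_mean (prod_weight_distr 'I_M dP)).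
under eq_bigr do rewrite mean_lyapunov_update // mulr_sumr.
rewrite exchange_big -sumrB /=; apply: ler_sum => i _.
rewrite (eq_bigr (fun g : {ffun 'I_M -> X} => L i * (prod_weight P g *
  mean_pot (W (g i)) (other_output L g i) (log_odds L i)))); last first.
  by move=> g _; rewrite mulrCA.
rewrite -mulr_sumr -[X in _ - X]mulr1 -mulrBr ler_pM2l //.
apply: mean_pot_random => //; first exact: prod_weight_distr.
  by move=> g; exact: other_output_ratio.
apply: le_trans hI _; apply: (mean_KL_random_encoder hW hc dP (other_weight_distr i L0)).
by rewrite /other_weight eqxx.
Qed.

Lemma drift_confirm L i : (forall j, 0 < L j) -> 0 < log_odds L i ->
  exists g : {ffun 'I_M -> X},
    \sum_y lyapunov (update L g y) <= lyapunov L - \sum_i L i.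
Proof.
move=> L0 hi; have ri := rest_gt0 i L0.
pose g := [ffun j => if j == i then x0 else x1]; exists g.
rewrite mean_lyapunov_update // (bigD1 i) //= [lyapunov L](bigD1 i) //=.
have gi : g i = x0 by rewrite ffunE eqxx.
have Qi : other_output L g i = W x1.
  apply/funext => y; rewrite -[RHS]mul1r -(other_weight_distr i L0).2 mulr_suml.
  apply: eq_bigr => j _; rewrite /other_weight ffunE.
  by case: eqP => //; rewrite !mul0r.
(* The surplus [L i * expR (- log_odds L i)] equals [rest L i], which completes [L i] to the total
   mass. *)
have h1 : L i * mean_pot (W (g i)) (other_output L g i) (log_odds L i) <=
    L i * pot (log_odds L i) - \sum_j L j.
  rewrite gi Qi (sum_rest L i).
  apply: le_trans (ler_wpM2l (ltW (L0 i)) (mean_pot_confirm (hW x0) (hc x0 x1) hx (ltW hi))) _.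
  rewrite expRN lnK ?posrE ?divr_gt0 // invf_div le_eqVlt; apply/orP; left.
  by apply/eqP; field; rewrite gt_eqF.
suff h2 : \sum_(j | j != i) L j * mean_pot (W (g j)) (other_output L g j) (log_odds L j)
    <= \sum_(j | j != i) L j * pot (log_odds L j) by lra.
apply: ler_sum => j ji; rewrite ler_pM2l //.
apply: mean_pot_le_pot; [exact: hW|exact: other_output_distr|exact: other_output_ratio|].
(* Message [i] outweighs all others together, so the log-odds of [j] are nonpositive:
   [L j <= rest L i < L i <= rest L j]. *)
apply: ln_le0; rewrite ler_pdivrMr ?rest_gt0 // mul1r.
have hLi : rest L i < L i.
  rewrite ltNge; apply/negP => h; move: hi; rewrite ltNge => /negP; apply.
  by apply: ln_le0; rewrite ler_pdivrMr // mul1r.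
apply: (@le_trans _ _ (rest L i)).
  by rewrite /rest (bigD1 j) //= lerDl sumr_ge0 // => k _; exact: ltW.
apply: le_trans (ltW hLi) _.
by rewrite /rest (bigD1 i) 1?eq_sym //= lerDl sumr_ge0 // => k _; exact: ltW.
Qed.

Lemma drift L : (forall j, 0 < L j) -> exists g : {ffun 'I_M -> X},
  \sum_y lyapunov (update L g y) <= lyapunov L - \sum_i L i.
Proof.
move=> L0; have [/existsP[i hi]|] := boolP [exists i, 0 < log_odds L i].
  exact: drift_confirm hi.
rewrite negb_exists => /forallP h; apply: drift_random => // i.
by rewrite leNgt.
Qed.

End Potential.

(** * Sums over output sequences and bounded series *)

Lemma sum_tuple_rcons (R : nmodType) (Y : finType) t (F : seq Y -> R) :
  \sum_(ys : t.+1.-tuple Y) F ys = \sum_(ys : t.-tuple Y) \sum_y F (rcons ys y).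
Proof.
pose h (p : t.-tuple Y * Y) : t.+1.-tuple Y := [tuple of rcons p.1 p.2].
have hb : bijective h.
  apply: inj_card_bij; last by rewrite card_prod !card_tuple expnSr.
  move=> [u x] [v y] /(congr1 val)/= /rcons_inj [uv ->].
  by congr (_, _); apply: val_inj.
rewrite (reindex h) /=; last exact: onW_bij.
by rewrite (pair_big xpredT xpredT (fun (ys : t.-tuple Y) y => F (rcons ys y))).
Qed.

Lemma sum_tuple0 (R : nmodType) (Y : finType) (F : seq Y -> R) :
  \sum_(ys : 0.-tuple Y) F ys = F [::].
Proof. by rewrite (big_pred1 [tuple]) // => ys; apply/esym/eqP; exact: tuple0. Qed.

Lemma bounded_series_cvg (R : realType) (u : nat -> R) (K : R) :
  (forall n, 0 <= u n) -> (forall n, \sum_(k < n) u k <= K) ->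
  exists l : R, [/\ (series u @ \oo --> l)%classic, l <= K & forall n, \sum_(k < n) u k <= l].
Proof.
move=> u0 uK.
have hs n : series u n = \sum_(k < n) u k by rewrite /series /= big_mkord.
have cv : cvgn (series u).
  apply: nondecreasing_is_cvgn; last first.
    by exists K => _ [n _ <-]; rewrite hs.
  by apply: nondecreasing_series => n _ _; exact: u0.
exists (limn (series u)); split=> //.
  by apply: limr_le => //; apply: nearW => n; rewrite hs.
move=> n; rewrite -hs; apply: nondecreasing_cvgn_le => //.
by apply: nondecreasing_series => k _ _; exact: u0.
Qed.

(** * The stopping code built from a drift function *)

Section Code.
Variables (R : realType) (X Y : finType) (W : X -> Y -> R) (c : R).
Variables (M : nat) (V : ('I_M -> R) -> R) (A B p0 : R) (x0 : X) (w0 : 'I_M).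
Implicit Types L : 'I_M -> R.

Hypotheses (hW : is_channel W) (hc : forall x x', ratio_bounded c (W x) (W x')).
Hypothesis M1 : (1 < M)%N.
Hypothesis hdrift : forall L, (forall j, 0 < L j) -> exists g : {ffun 'I_M -> X},
  \sum_y V (update W L g y) <= V L - \sum_i L i.
Hypothesis V_zero : V (fun=> 0) = 0.
Hypothesis V_ge : forall L, (forall j, 0 < L j) ->
  (forall i, log_odds L i <= ln A + c) -> - (B * \sum_i L i) <= V L.
Hypotheses (c0 : 0 <= c) (A1 : 1 <= A) (p00 : 0 <= p0) (p01 : p0 <= 1).

(** The default map is never taken when all [L j] are positive, by [hdrift]. *)
Definition next_map L : {ffun 'I_M -> X} :=
  odflt [ffun=> x0]
    [pick g : {ffun 'I_M -> X} | \sum_y V (update W L g y) <= V L - \sum_i L i].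

(** Carrying the weights along the outputs breaks the circularity between encoder and posterior. *)
Definition joint (ys : seq Y) : 'I_M -> R :=
  foldl (fun L y => update W L (next_map L) y) (fun=> M%:R^-1) ys.
Definition encoder (w : 'I_M) (ys : seq Y) : X := next_map (joint ys) w.
(** In product form this also holds when [joint ys] vanishes, so sequences of probability zero count
    as stopped. *)
Definition confident (ys : seq Y) (i : 'I_M) := A * rest (joint ys) i <= joint ys i.
Definition stopped (ys : seq Y) := [exists i, confident ys i].
Definition decoder (ys : seq Y) := odflt w0 [pick i | confident ys i].
(** Only strict prefixes are tested: an alive sequence may stop now. *)
Definition alive (ys : seq Y) := all (fun s => ~~ stopped (take s ys)) (iota 0 (size ys)).
Definition mass (ys : seq Y) := \sum_w joint ys w.

Lemma joint_rcons ys y w : joint (rcons ys y) w = joint ys w * W (encoder w ys) y.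
Proof. by rewrite /joint foldl_rcons. Qed.

Lemma joint_path_prob past ys w :
  joint past w * path_prob W (encoder w) past ys = joint (past ++ ys) w.
Proof.
elim: ys past => [|y ys IH] past /=; first by rewrite mulr1 cats0.
by rewrite mulrA -joint_rcons IH cat_rcons.
Qed.

Lemma joint_ge0 ys w : 0 <= joint ys w.
Proof.
elim/last_ind: ys => [|ys y IH]; first by rewrite /= invr_ge0.
by rewrite joint_rcons mulr_ge0 // (hW _).1.
Qed.

(** By [hc] an output is impossible under one input only if it is under all. *)
Lemma joint_gt0_or_zero ys : (forall w, 0 < joint ys w) \/ joint ys = (fun=> 0).
Proof.
elim/last_ind: ys => [|ys y [IH|IH]].
- by left=> w /=; rewrite invr_gt0 ltr0n ltnW.
- have [[w hw]|h] := pselect (exists w, joint (rcons ys y) w = 0).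
    right; apply/funext => w'; move: hw; rewrite joint_rcons => /eqP.
    rewrite mulf_eq0 gt_eqF //= => /eqP Wy; rewrite joint_rcons.
    have := (hc (encoder w' ys) (encoder w ys) y).1; rewrite Wy mulr0 => h.
    have -> : W (encoder w' ys) y = 0 by apply/le_anti; rewrite h (hW _).1.
    by rewrite mulr0.
  left=> w; rewrite lt_neqAle joint_ge0 andbT eq_sym; apply/eqP => hw.
  by apply: h; exists w.
- by right; apply/funext => w; rewrite joint_rcons IH mul0r.
Qed.

Lemma sum_mass ys : \sum_y mass (rcons ys y) = mass ys.
Proof.
rewrite exchange_big; apply: eq_bigr => w _ /=.
by under eq_bigr do rewrite joint_rcons; rewrite -mulr_sumr (hW _).2 mulr1.
Qed.

Lemma mass_ge0 ys : 0 <= mass ys.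
Proof. by apply: sumr_ge0 => w _; exact: joint_ge0. Qed.

Lemma mass_nil : mass [::] = 1.
Proof.
rewrite /mass /= sumr_const card_ord -[RHS](@mulVf _ M%:R) ?mulr_natr //.
by rewrite pnatr_eq0 -lt0n ltnW.
Qed.

Lemma alive_rcons ys y : alive (rcons ys y) = alive ys && ~~ stopped ys.
Proof.
rewrite /alive size_rcons -addn1 iotaD all_cat /= add0n andbT.
rewrite -cats1 takel_cat // take_size; congr (_ && _).
apply: eq_in_all => s; rewrite mem_iota add0n => /andP[_ hs].
by rewrite takel_cat // ltnW.
Qed.

Lemma joint_gt0 ys : ~~ stopped ys -> forall w, 0 < joint ys w.
Proof.
case: (joint_gt0_or_zero ys) => // h /existsP[]; exists w0.
by rewrite /confident h /rest big1 // mulr0.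
Qed.

Lemma V_drift ys : ~~ stopped ys ->
  \sum_y V (joint (rcons ys y)) <= V (joint ys) - mass ys.
Proof.
move=> h; have L0 := joint_gt0 h.
rewrite (eq_bigr (fun y => V (update W (joint ys) (next_map (joint ys)) y))); last first.
  by move=> y _; rewrite {1}/joint foldl_rcons.
rewrite /next_map; case: pickP => //= hn.
by have [g] := hdrift L0; rewrite hn.
Qed.

(** One step earlier all odds were below [A], and the last output adds at most [c] to the
    log-odds. *)
Lemma V_joint_ge ys : alive ys -> - (B * mass ys) <= V (joint ys).
Proof.
case: (joint_gt0_or_zero ys) => [L0|h0]; last first.
  by rewrite /mass h0 V_zero big1 // mulr0 oppr0.
have A0 : 0 < A := lt_le_trans ltr01 A1.
move=> hal; apply: V_ge => // i; move: L0 hal.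
case/lastP: ys => [L0 _|ys y L0].
  apply: (@le_trans _ _ 0); last by rewrite addr_ge0 // ln_ge0.
  by have /andP[] := log_odds_uniform R M1 i.
rewrite alive_rcons => /andP[_ hns]; have L1 := joint_gt0 hns.
have Wy : 0 < W (next_map (joint ys) i) y.
  by have := L0 i; rewrite joint_rcons pmulr_rgt0.
have -> : joint (rcons ys y) = update W (joint ys) (next_map (joint ys)) y.
  by rewrite {1}/joint foldl_rcons.
rewrite (log_odds_update hc M1) // lerD //; last first.
  have [_] := log_ratio_le (other_output_ratio hc M1 (next_map (joint ys)) i L1) Wy.
  by rewrite ler_norml => /andP[].
have r0 := rest_gt0 M1 i L1.
rewrite ler_ln ?posrE ?divr_gt0 // ler_pdivrMr //.
by move: hns; rewrite negb_exists => /forallP /(_ i); rewrite /confident -ltNge => /ltW.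
Qed.

(** Before time sharing, with stopping time [tau], these are the probabilities of [tau >= t], of
    [tau = t], and of [tau = t] with correct decoding. So [surviving k.+1] is that of [tau > k]. *)
Definition surviving t := \sum_(ys : t.-tuple Y) (alive ys)%:R * mass ys.
Definition stopping t := \sum_(ys : t.-tuple Y) (stopped ys && alive ys)%:R * mass ys.
Definition stopping_correct t :=
  \sum_(ys : t.-tuple Y) (stopped ys && alive ys)%:R * joint ys (decoder ys).
Definition energy t := \sum_(ys : t.-tuple Y) (alive ys)%:R * V (joint ys).
Definition energy_lost t :=
  \sum_(ys : t.-tuple Y) (stopped ys && alive ys)%:R * V (joint ys).

Lemma surviving0 : surviving 0 = 1.
Proof. by rewrite /surviving (sum_tuple0 (fun ys => (alive ys)%:R * mass ys)) mul1r mass_nil. Qed.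

Lemma survivingS t : surviving t = stopping t + surviving t.+1.
Proof.
rewrite /surviving (sum_tuple_rcons _ (fun ys => (alive ys)%:R * mass ys)) -big_split /=.
apply: eq_bigr => ys _; under [X in _ = _ + X]eq_bigr do rewrite alive_rcons.
rewrite -mulr_sumr sum_mass -mulrDl; congr (_ * _).
by case: (alive ys); case: (stopped ys); rewrite /= ?addr0 ?add0r.
Qed.

Lemma surviving_ge0 t : 0 <= surviving t.
Proof. by apply: sumr_ge0 => ys _; rewrite mulr_ge0 // mass_ge0. Qed.

Lemma stopping_ge0 t : 0 <= stopping t.
Proof. by apply: sumr_ge0 => ys _; rewrite mulr_ge0 // mass_ge0. Qed.

Lemma energyS t : energy t.+1 <= energy t - energy_lost t - surviving t.+1.
Proof.
rewrite /energy /surviving (sum_tuple_rcons _ (fun ys => (alive ys)%:R * V (joint ys))).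
rewrite (sum_tuple_rcons _ (fun ys => (alive ys)%:R * mass ys)) -!sumrB.
apply: ler_sum => ys _.
under eq_bigr do rewrite alive_rcons.
under [X in _ <= _ - X]eq_bigr do rewrite alive_rcons.
rewrite -!mulr_sumr sum_mass.
case: (alive ys); rewrite ?andbF ?mul0r ?subrr //= andbT.
case: (boolP (stopped ys)) => h /=; rewrite ?mul0r !mul1r ?subrr // subr0.
exact: V_drift.
Qed.

Lemma sum_stopping n : \sum_(k < n) stopping k = 1 - surviving n.
Proof.
elim: n => [|n IH]; first by rewrite big_ord0 surviving0 subrr.
by rewrite big_ord_recr /= IH [surviving n]survivingS; ring.
Qed.

Let T := V (fun=> M%:R^-1) + B.

(** Optional stopping: [energyS] telescopes, and the energy lost or remaining is at least [- B]
    times a total mass of 1. *)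
Lemma sum_surviving_le n : \sum_(k < n) surviving k.+1 <= T.
Proof.
have h1 t : - (B * surviving t) <= energy t.
  rewrite /energy /surviving mulr_sumr -sumrN; apply: ler_sum => ys _.
  by case: (boolP (alive ys)) => h; rewrite ?mul0r ?mulr0 ?oppr0 // !mul1r V_joint_ge.
have h2 t : - (B * stopping t) <= energy_lost t.
  rewrite /stopping /energy_lost mulr_sumr -sumrN; apply: ler_sum => ys _.
  case: (boolP (stopped ys && alive ys)) => h; rewrite ?mul0r ?mulr0 ?oppr0 // !mul1r.
  by apply: V_joint_ge; case/andP: h.
have h3 : energy n + \sum_(k < n) surviving k.+1 + \sum_(k < n) energy_lost k <= energy 0.
  elim: n => [|n IH]; first by rewrite !big_ord0 !addr0.
  by rewrite !big_ord_recr /=; have := energyS n; lra.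
have h4 : - (B * \sum_(k < n) stopping k) <= \sum_(k < n) energy_lost k.
  by rewrite mulr_sumr -sumrN; apply: ler_sum.
have h5 : energy 0 = V (fun=> M%:R^-1).
  by rewrite /energy (sum_tuple0 (fun ys => (alive ys)%:R * V (joint ys))) mul1r.
by rewrite sum_stopping in h4; have := h1 n; rewrite /T -h5; lra.
Qed.

Lemma surviving_noninc m n : (m <= n)%N -> surviving n <= surviving m.
Proof.
move=> /subnK <-; elim: (n - m)%N => [|k IH]; first by rewrite add0n.
by rewrite addSn; have := survivingS (k + m); have := stopping_ge0 (k + m); lra.
Qed.

(** By monotonicity [n.+1] copies of [surviving n.+1] sum to at most [T]. *)
Lemma surviving_cvg0 : (surviving @ \oo --> (0 : R))%classic.
Proof.
rewrite -(cvg_shiftS surviving) /=.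
have h : ((fun n => T * harmonic n) @ \oo --> (0 : R))%classic.
  by rewrite -[X in (_ --> X)%classic](mulr0 T); apply: cvgMr; exact: cvg_harmonic.
apply: squeeze_cvgr _ (cvg_cst 0) h; apply: nearW => n.
rewrite surviving_ge0 /= /harmonic /= ler_pdivlMr // mulrC mulr_natl.
apply: le_trans (sum_surviving_le n.+1).
have -> : surviving n.+1 *+ n.+1 = \sum_(k < n.+1) surviving n.+1.
  by rewrite sumr_const card_ord.
apply: ler_sum => k _.
exact: surviving_noninc (ltn_ord k).
Qed.

Lemma stopping_cvg : (series stopping @ \oo --> (1 : R))%classic.
Proof.
have -> : series stopping = fun n => 1 - surviving n.
  by apply/funext => n; rewrite /series /= big_mkord sum_stopping.
by rewrite -[X in (_ --> X)%classic](subr0 1); apply: cvgB surviving_cvg0; exact: cvg_cst.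
Qed.

Lemma mean_stopping_le n : \sum_(t < n) t%:R * stopping t <= T.
Proof.
(* Summation by parts. *)
have -> : \sum_(t < n) t%:R * stopping t = \sum_(k < n) surviving k.+1 - n%:R * surviving n.
  elim: n => [|n IH]; first by rewrite !big_ord0 mul0r subrr.
  by rewrite !big_ord_recr /= IH [surviving n]survivingS -natr1; ring.
by apply: le_trans (sum_surviving_le n); rewrite gerBl mulr_ge0 // surviving_ge0.
Qed.

(** At stopping the decoded message has odds at least [A], so the others hold at most [A^-1] of the
    mass. *)
Lemma stopping_correct_ge t : (1 - A^-1) * stopping t <= stopping_correct t.
Proof.
have A0 : 0 < A := lt_le_trans ltr01 A1.
rewrite mulr_sumr; apply: ler_sum => ys _.
case: (boolP (stopped ys && alive ys)) => h; rewrite ?mul0r ?mulr0 // !mul1r.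
rewrite /decoder; case: pickP => [i /= hi|hn]; last first.
  by case/andP: h => /existsP[i]; rewrite hn.
rewrite /mass (sum_rest _ i).
have : rest (joint ys) i <= A^-1 * joint ys i by rewrite ler_pdivlMl.
have : 0 <= rest (joint ys) i by apply: sumr_ge0 => j _; exact: joint_ge0.
have : 0 <= A^-1 by rewrite invr_ge0 ltW.
nra.
Qed.

Lemma sum_mass_tuple t : \sum_(ys : t.-tuple Y) mass ys = 1.
Proof.
elim: t => [|t IH]; first by rewrite sum_tuple0 mass_nil.
by rewrite sum_tuple_rcons -[RHS]IH; apply: eq_bigr => ys _; exact: sum_mass.
Qed.

(* Time sharing: the code stops at time 0 when the shared bit is true. *)
Definition shared_bit (u : bool) : R := if u then p0 else 1 - p0.
Definition shared_encoder (u : bool) := encoder.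
Definition shared_stop (u : bool) ys := u || stopped ys.
Definition shared_decoder (u : bool) := decoder.

Lemma shared_bit_distr : is_distr shared_bit.
Proof.
split; first by case; rewrite /= ?subr_ge0.
by rewrite big_bool /= addrC subrK.
Qed.

Lemma stops_at_true ys : stops_at shared_stop true ys = (size ys == 0%N).
Proof. by case: ys. Qed.

Lemma prob_term (q b : R) u w ys :
  q * M%:R^-1 * path_prob W (shared_encoder u w) [::] ys * b = q * (joint ys w * b).
Proof. by rewrite -[in RHS](cat0s ys) -joint_path_prob /= !mulrA. Qed.

Lemma prob_tauE t :
  prob_tau W shared_bit shared_encoder shared_stop t =
  p0 * (t == 0%N)%:R + (1 - p0) * stopping t.
Proof.
rewrite /prob_tau big_bool /=; congr (_ + _).
  transitivity (\sum_(ys : t.-tuple Y) p0 * (mass ys * (t == 0%N)%:R)); last first.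
    by rewrite -mulr_sumr -mulr_suml sum_mass_tuple mul1r.
  rewrite exchange_big; apply: eq_bigr => ys _ /=.
  rewrite /mass mulr_suml mulr_sumr; apply: eq_bigr => w _.
  by rewrite stops_at_true size_tuple prob_term.
rewrite exchange_big mulr_sumr /=.
apply: eq_bigr => ys _; rewrite /mass !mulr_sumr; apply: eq_bigr => w _.
by rewrite prob_term [joint _ _ * _]mulrC.
Qed.

(** The lower bound counts each run stopped by the shared bit as an error; the upper one serves
    convergence. *)
Lemma prob_tau_correct_bounds t :
  (1 - p0) * stopping_correct t <=
    prob_tau_correct W shared_bit shared_encoder shared_stop shared_decoder t <=
    prob_tau W shared_bit shared_encoder shared_stop t.
Proof.
have p0' : 0 <= 1 - p0 by rewrite subr_ge0.
apply/andP; split; last first.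
  apply: ler_sum => u _; apply: ler_sum => w _; apply: ler_sum => ys _.
  rewrite !prob_term; apply: ler_wpM2l; first exact: shared_bit_distr.1.
  apply: ler_wpM2l; first exact: joint_ge0.
  by case: stops_at => //=; case: eqP.
rewrite /prob_tau_correct big_bool /= -[leLHS]add0r lerD //.
  apply: sumr_ge0 => w _; apply: sumr_ge0 => ys _.
  by rewrite prob_term mulr_ge0 // mulr_ge0 // joint_ge0.
rewrite exchange_big mulr_sumr /= le_eqVlt; apply/orP; left; apply/eqP.
apply: eq_bigr => ys _; under [RHS]eq_bigr do rewrite prob_term.
rewrite -mulr_sumr (bigD1 (decoder ys)) //= eqxx andbT big1 => [|w hw].
  by rewrite addr0 [joint _ _ * _]mulrC.
by rewrite eq_sym (negbTE hw) andbF mulr0.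
Qed.

Lemma random_code_exists (N eps : R) :
  (1 - p0) * T <= N -> 1 - (1 - p0) * (1 - A^-1) <= eps -> VLF_code_exists W N M eps.
Proof.
move=> hN heps; have p0' : 0 <= 1 - p0 by rewrite subr_ge0.
have sum0 n : \sum_(k < n) (k == 0%N :> nat)%:R <= 1 :> R.
  case: n => [|n]; first by rewrite big_ord0.
  by rewrite big_ord_recl big1 ?addr0.
have A0 : 0 < A := lt_le_trans ltr01 A1.
have A1' : 0 <= 1 - A^-1 by rewrite subr_ge0 invf_le1.
have cvg_tau : (series (prob_tau W shared_bit shared_encoder shared_stop) @ \oo
    --> (1 : R))%classic.
  (* The shift puts the atom [p0] at time 0 into every partial sum. *)
  rewrite -(cvg_shiftS _) /=.
  have -> : (fun n => series (prob_tau W shared_bit shared_encoder shared_stop) n.+1)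
      = fun n => p0 + (1 - p0) * series stopping n.+1.
    apply/funext => n; rewrite /series /= !big_mkord.
    under eq_bigr do rewrite prob_tauE.
    rewrite big_split /= -!mulr_sumr; congr (_ + _).
    by rewrite big_ord_recl big1 //= addr0 mulr1.
  have h : ((fun n => p0 + (1 - p0) * series stopping n.+1) @ \oo -->
      p0 + (1 - p0) * 1)%classic.
    apply: cvgD; first exact: cvg_cst.
    by apply: cvgMr; rewrite (cvg_shiftS (series stopping)); exact: stopping_cvg.
  have e : p0 + (1 - p0) * 1 = 1 by ring.
  by rewrite e in h.
have [|n|Etau [cvgE hE _]] := @bounded_series_cvg R
    (fun t => t%:R * prob_tau W shared_bit shared_encoder shared_stop t) N.
- move=> t; rewrite prob_tauE mulr_ge0 // addr_ge0 // mulr_ge0 //.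
  exact: stopping_ge0.
- apply: le_trans hN; apply: le_trans (ler_wpM2l p0' (mean_stopping_le n)).
  rewrite mulr_sumr le_eqVlt; apply/orP; left; apply/eqP; apply: eq_bigr => t _.
  by rewrite prob_tauE; case: (nat_of_ord t) => [|k]; rewrite ?mul0r ?mulr0 //=; ring.
have [|n|Pc [cvgP _ hP]] := @bounded_series_cvg R
    (prob_tau_correct W shared_bit shared_encoder shared_stop shared_decoder) 1.
- move=> t; have /andP[h _] := prob_tau_correct_bounds t; apply: le_trans h.
  by rewrite mulr_ge0 // sumr_ge0 // => ys _; rewrite mulr_ge0 // joint_ge0.
- apply: (@le_trans _ _ (\sum_(k < n) prob_tau W shared_bit shared_encoder shared_stop k)).
    by apply: ler_sum => t _; have /andP[] := prob_tau_correct_bounds t.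
  under eq_bigr do rewrite prob_tauE.
  rewrite big_split /= -!mulr_sumr sum_stopping.
  have := ler_wpM2l p00 (sum0 n); have := ler_wpM2l p0' (surviving_ge0 n); lra.
exists bool, shared_bit, shared_encoder, shared_stop, shared_decoder; split.
- exact: shared_bit_distr.
- exact: cvg_tau.
- by exists Etau.
exists Pc; split => //; apply: le_trans heps; rewrite lerD2l lerN2.
have hlim : ((fun n => (1 - p0) * (1 - A^-1) * (1 - surviving n)) @ \oo -->
    (1 - p0) * (1 - A^-1) * (1 - 0))%classic.
  by apply: cvgMr; apply: cvgB surviving_cvg0; exact: cvg_cst.
rewrite subr0 mulr1 in hlim; rewrite -(cvg_lim _ hlim) //; apply: limr_le.
  by apply/cvg_ex; eexists; exact: hlim.
apply: nearW => n; apply: le_trans (hP n); rewrite -sum_stopping -mulrA.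
rewrite !mulr_sumr; apply: ler_sum => t _.
have /andP[h _] := prob_tau_correct_bounds t; apply: le_trans h.
by rewrite ler_wpM2l // stopping_correct_ge.
Qed.

End Code.

(** * Channel constants and choice of parameters *)

Section Constants.
Variable R : realType.

Lemma C1_finite_ratio_bounded (X Y : finType) (W : X -> Y -> R) :
  is_channel W -> C1_finite W ->
  exists2 c, 1 <= c & forall x x', ratio_bounded c (W x) (W x').
Proof.
move=> hW hf.
pose F (p : X * X * Y) := `|ln (W p.1.1 p.2 / W p.1.2 p.2)|.
exists (1 + \sum_p F p) => [|x x']; first by rewrite lerDl sumr_ge0 // => p _; exact: normr_ge0.
suff h x1 x2 y : W x1 y <= expR (1 + \sum_p F p) * W x2 y by move=> y; split.
have := (hW x2).1 y; rewrite le_eqVlt => /orP[/eqP/esym W0|W2].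
  by rewrite W0 mulr0 (hf x1 x2).
have := (hW x1).1 y; rewrite le_eqVlt => /orP[/eqP <-|W1].
  by rewrite mulr_ge0 ?expR_ge0 // ltW.
rewrite -ler_pdivrMr // -[leLHS]lnK ?posrE ?divr_gt0 // ler_expR.
apply: (@le_trans _ _ (F (x1, x2, y))); first exact: ler_norm.
rewrite (bigD1 (x1, x2, y)) //= addrCA lerDl addr_ge0 // sumr_ge0 // => p _.
exact: normr_ge0.
Qed.

(** Uniformity in [Cp] matters: the input law will vary with [N] while [b] enters the constant
    term. *)
Lemma potential_parameters (C c : R) : 0 < C -> 1 <= c -> exists s a b : R,
  [/\ 0 <= s, s <= 1, s * c <= 2^-1 & 0 <= a] /\ forall Cp, C / 2 <= Cp ->
  [/\ 2 * (s * c) ^+ 2 <= s * Cp / 2, 1 <= a * (s * Cp / 2) & a + c / Cp <= b].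
Proof.
move=> C0 c1; have c0 : 0 < c := lt_le_trans ltr01 c1.
pose s := Num.min (2 * c)^-1 (C / (8 * c ^+ 2)).
have s0 : 0 < s.
  by rewrite lt_min invr_gt0 divr_gt0 ?mulr_gt0 // exprn_gt0.
have sc : s * c <= 2^-1.
  have h : s <= (2 * c)^-1 by rewrite ge_min lexx.
  apply: le_trans (ler_wpM2r (ltW c0) h) _; rewrite le_eqVlt; apply/orP; left.
  by apply/eqP; field; rewrite gt_eqF.
have scc : s * c ^+ 2 <= C / 8.
  have h : s <= C / (8 * c ^+ 2) by rewrite ge_min lexx orbT.
  have cc0 : 0 < c ^+ 2 by rewrite exprn_gt0.
  apply: le_trans (ler_wpM2r (ltW cc0) h) _; rewrite le_eqVlt; apply/orP; left.
  by apply/eqP; field; rewrite gt_eqF.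
exists s, (4 / (s * C)), (4 / (s * C) + c / (C / 2)); split.
  split=> //; [exact: ltW|nra|].
  by rewrite divr_ge0 // ltW // mulr_gt0.
move=> Cp hCp; have Cp0 : 0 < Cp by apply: lt_le_trans hCp; rewrite divr_gt0.
split.
- have -> : 2 * (s * c) ^+ 2 = 2 * s * (s * c ^+ 2) by ring.
  have := ler_wpM2l (ltW s0) scc; have := ler_wpM2l (ltW s0) hCp; nra.
- have -> : 4 / (s * C) * (s * Cp / 2) = 2 * Cp / C.
    by field; rewrite !gt_eqF.
  by rewrite ler_pdivlMr // mul1r; lra.
- by rewrite lerD2l ler_pM2l // lef_pV2 ?posrE // divr_gt0.
Qed.

(** For [M] the integer part of [expR E], rounding costs [ln 2] because [expR E < M + 1 <= 2 M]. *)
Lemma message_count (E : R) : 1 <= E ->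
  exists M : nat, [/\ (1 < M)%N, ln (M%:R : R) <= E & E - ln 2 <= ln (M%:R : R)].
Proof.
move=> E1; have hE : 2 <= expR E by apply: le_trans (expR_ge1Dx E); lra.
have /andP[h1 h2] := truncn_itv (expR_ge0 E).
exists (Num.trunc (expR E)); set M := Num.trunc _ in h1 h2 *.
have M1 : (1 < M)%N.
  by rewrite -ltnS -(ltr_nat R) (le_lt_trans hE).
have M0 : 0 < M%:R :> R by rewrite ltr0n ltnW.
split=> //; first by rewrite -ler_expR lnK.
rewrite lerBlDr -lnM ?posrE // -ler_expR lnK ?posrE ?mulr_gt0 //.
apply: le_trans (ltW h2) _; rewrite -natr1 mulr_natr mulr2n lerD2l.
by rewrite ler1n ltnW.
Qed.

Lemma ln_le_linear (e x : R) : 0 < e -> 0 < x -> ln x <= e * x - 1 - ln e.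
Proof.
move=> e0 x0; rewrite lerBrDr -lnM ?posrE // mulrC.
rewrite -[X in ln X](subrK 1) addrC; apply: le_ln1Dx.
by rewrite -subr_gt0 opprK subrK mulr_gt0.
Qed.

Lemma capacity_near (X Y : finType) (W : X -> Y -> R) (e : R) :
  0 < capacity W -> 0 < e ->
  exists P, [/\ is_distr P, mutual_info P W <= capacity W & capacity W - e < mutual_info P W].
Proof.
move=> hC e0; rewrite /capacity in hC *; set S := (X in sup X) in hC *.
(* [sup] defaults to 0 on a set without supremum, which positivity excludes. *)
have hS : has_sup S by apply: contrapT => /sup_out h; rewrite h ltxx in hC.
have [r [P [dP ->]] hr] := sup_adherent e0 hS.
by exists P; split=> //; apply: ub_le_sup; [case: hS|exists P].
Qed.

(** Positivity rules out the default 0 of the maximum. *)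
Lemma C1_attained (X Y : finType) (W : X -> Y -> R) : 0 < C1 W ->
  exists x x', KL (W x) (W x') = C1 W.
Proof.
move=> h; apply: contrapT => hn; move: h; rewrite ltNge => /negP; apply.
have : C1 W = 0 \/ exists xx : X * X, C1 W = KL (W xx.1) (W xx.2).
  apply: (big_ind (fun r => r = 0 \/ exists xx : X * X, r = KL (W xx.1) (W xx.2))).
  - by left.
  - by move=> r1 r2 h1 h2; rewrite /Num.max; case: ifP.
  - by move=> xx _; right; exists xx.
by case=> [->//|[[x x'] /= hx]]; case: hn; exists x, x'.
Qed.

End Constants.

(** * The asymptotic lower bound *)

Theorem theorem2 (R : realType) (X Y : finType) (W : X -> Y -> R)
  (hW : is_channel W) (hC : 0 < capacity W) (hC1 : C1_finite W)
  (eps : R) (heps0 : 0 < eps) (heps1 : eps < 1) :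
  exists K : R, exists N0 : R, forall N : R, N0 <= N ->
    exists M : nat, VLF_code_exists W N M eps /\
      N * capacity W / (1 - eps) - capacity W / C1 W * ln N - ln (ln N) - K
        <= ln (M%:R : R).
Proof.
have [c c1 hc] := C1_finite_ratio_bounded hW hC1.
set C := capacity W in hC *; set D := C1 W.
have [s [a [b [[s0 s1 sc a0] hCp]]]] := potential_parameters hC c1.
have c0 : 0 <= c := le_trans ler01 c1.
have DC (P : X -> R) : is_distr P -> mutual_info P W <= D by exact: mutual_info_le_C1 hW hc.
have D0 : 0 < D.
  have [P [dP _ hP]] := capacity_near hC hC.
  by apply: lt_le_trans (DC _ dP); rewrite subrr in hP.
have [x0 [x1 hx]] := C1_attained D0.
pose q := 1 - eps; have q0 : 0 < q by rewrite subr_gt0.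
(* In order, the losses come from the near-optimal input law, the [N^-1] in [p0], the offset of the
   potential, the overshoot, and rounding [M]. *)
exists (C / q + C / q ^+ 2 + C * b + C / D * c + ln 2).
pose k := b + c / D - (1 + ln (D / 2)) / D.
(* These give [0 <= ln (ln N)], [C / 2 <= Cp], [0 <= p0], and [2 / C <= F], so that [M] is at least
   2. *)
exists (Num.max (Num.max (expR 1) (Num.max 2 eps^-1)) (2 * (2 / C + k))) => N.
rewrite !ge_max => /andP[/andP[Ne /andP[N2 Neps]] Nk].
have N0 : 0 < N by lra.
(* A gap of [C / N] costs only [C / q] once multiplied by [N / q]. *)
have [P [dP hPC hPe]] := capacity_near hC (divr_gt0 hC N0).
set Cp := mutual_info P W in hPC hPe; have CpD : Cp <= D := DC P dP.
have Cp2 : C / 2 <= Cp.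
  apply: ltW; apply: le_lt_trans hPe.
  have : C / N <= C / 2 by rewrite ler_pM2l // lef_pV2 ?posrE.
  by rewrite -/C; lra.
have Cp0 : 0 < Cp by apply: lt_le_trans Cp2; rewrite divr_gt0.
have [sc2 asC bac] := hCp _ Cp2.
have lnN0 : 1 <= ln N by rewrite -ler_expR lnK.
have NV : 0 < N^-1 by rewrite invr_gt0.
have NVe : N^-1 <= eps by rewrite -[eps]invrK lef_pV2 ?posrE // invr_gt0.
(* With odds threshold [N], the error is at most [p0 + N^-1 = eps]. *)
pose p0 := eps - N^-1.
have hp0 : 1 - p0 = q + N^-1 by rewrite /p0 /q; ring.
have r0 : 0 < q + N^-1 by rewrite addr_gt0.
have r1 : q + N^-1 <= 1 by rewrite /q; lra.
(* The largest [ln M / Cp] that the bound on the mean stopping time allows. *)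
pose F := N / (q + N^-1) - b - (ln N + c) / D.
have hF : 2 / C <= F.
  have : N <= N / (q + N^-1) by rewrite ler_pdivlMr // ler_piMr // ltW.
  have D2 : 0 < D / 2 by rewrite divr_gt0.
  have hl : ln N / D <= N / 2 - (1 + ln (D / 2)) / D.
    rewrite ler_pdivrMr //; apply: le_trans (ln_le_linear D2 N0) _.
    by rewrite le_eqVlt; apply/orP; left; apply/eqP; field; rewrite gt_eqF.
  rewrite /F [(ln N + c) / D]mulrDl; move: Nk hl; rewrite /k.
  by move: (2 / C) (N / (q + N^-1)) (ln N / D) (c / D) ((1 + _) / D) => *; lra.
have E1 : 1 <= Cp * F.
  have e : C / 2 * (2 / C) = 1 by field; rewrite gt_eqF.
  by rewrite -e; apply: ler_pM => //; apply: divr_ge0 => //; exact: ltW.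
have [M [M1 hM1 hM2]] := message_count E1.
have lnNc0 : 0 <= ln N + c by lra.
exists M; split.
  have N1 : 1 <= N by lra.
  apply: (@random_code_exists _ _ _ W c M (@lyapunov R Cp D s a b M) N ((ln N + c) / D) p0
    x0 (Ordinal M1) hW hc M1).
  - exact: (drift Cp0 CpD s0 s1 c0 sc sc2 a0 asC bac hW hc dP (lexx _) hx M1).
  - by rewrite /lyapunov big1 // => i _; rewrite mul0r.
  - by move=> L L0 hL; exact: (lyapunov_ge s Cp0 CpD c0 a0 bac lnNc0 L0 hL).
  - exact: c0.
  - exact: N1.
  - by rewrite subr_ge0.
  - by rewrite /p0; lra.
  - rewrite hp0 mulrC -ler_pdivlMr //.
    have := lyapunov_uniform Cp0 CpD s0 c0 a0 bac M1.
    have : ln M%:R / Cp <= F by rewrite ler_pdivrMr // mulrC.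
    by rewrite /F; lra.
  - have p01 : 1 - p0 <= 1 by rewrite hp0.
    have := ler_wpM2r (ltW NV) p01; rewrite mulrBr mulr1 /p0; lra.
apply: le_trans hM2.
have hll : 0 <= ln (ln N) by rewrite ln_ge0.
have hq : N / q - (q ^+ 2)^-1 <= N / (q + N^-1).
  have -> : N / (q + N^-1) = N / q - (q * (q + N^-1))^-1.
    by field; rewrite !gt_eqF // addr_gt0 // ?mulr_gt0.
  rewrite lerD2l lerN2 lef_pV2 ?posrE ?mulr_gt0 ?exprn_gt0 //.
  by rewrite expr2 ler_pM2l // lerDl ltW.
have h1 : C * (N / q) - C / q - C / q ^+ 2 <= Cp * (N / (q + N^-1)).
  have hCN : (C - C / N) * (N / q) = C * (N / q) - C / q.
    by field; rewrite !gt_eqF.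
  have h2 : (C - C / N) * (N / q) <= Cp * (N / q).
    by rewrite ler_wpM2r ?divr_ge0 // ltW.
  have h3 := ler_wpM2l (ltW Cp0) hq.
  have h4 : Cp / q ^+ 2 <= C / q ^+ 2.
    by rewrite ler_wpM2r // invr_ge0 exprn_ge0 // ltW.
  rewrite mulrBr in h3; lra.
have b0 : 0 <= b by apply: le_trans bac; rewrite addr_ge0 // divr_ge0 // ltW.
have h5 : Cp * b <= C * b by rewrite ler_wpM2r.
have h6 : Cp * ((ln N + c) / D) <= C * ((ln N + c) / D).
  by rewrite ler_wpM2r // divr_ge0 // ltW.
have e1 : N * C / q = C * (N / q) by rewrite mulrAC mulrC.
have e2 : C * ((ln N + c) / D) = C / D * ln N + C / D * c by ring.
by rewrite -/q e1 /F !mulrBr; lra.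
Qed.
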